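(* Let $s\ge2$ and $q=2^s$. There is a $2^s\,C^{s-1}Z\to 2\,C^{s-1}Z$ distillation protocol at distance $2$: let $G\in\mathbb F_q^{3\times q}$ have columns indexed by $x\in\mathbb F_q$ and rows $(x^2)_{x},\ (x)_{x},\ (1)_{x}$, the first two being logical rows and the third a stabilizer row. Then $G$ has full rank, and for all $a_1,\dots,a_s\in\{1,2,3\}$ $$\sum_{x\in\mathbb F_q}(g_{a_1,x})^{2^0}(g_{a_2,x})^{2^1}\cdots(g_{a_s,x})^{2^{s-1}}=\begin{cases}1&\text{if }a_1=\dots=a_s\in\{1,2\}\\0&\text{otherwise;}\end{cases}$$ consequently applying the norm gate $N$ (equivalently $C^{s-1}Z$ up to Paulis) to each of the $2^s$ physical qudits acts on the code as the logical $N^{\otimes2}$; and the $Z$-distance of the code is $2$.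
   Context: An $\mathbb F_q$-qudit ($q=2^s$), with basis $|\gamma\rangle$, $\gamma\in\mathbb F_q$, is identified with $s$ qubits via an $\mathbb F_2$-basis of $\mathbb F_q$. The norm gate is $N|\gamma\rangle=(-1)^{\gamma^{q-1}}|\gamma\rangle$ (where $\gamma^{q-1}\in\{0,1\}$); up to global phase it equals $X^{\otimes s}\,C^{s-1}Z\,X^{\otimes s}$, where $C^{s-1}Z|b_1\cdots b_s\rangle=(-1)^{b_1\cdots b_s}|b_1\cdots b_s\rangle$. A full-rank matrix $G\in\mathbb F_q^{m\times n}$ with rows $\mathbf g_1,\dots,\mathbf g_m$ and $k$ logical rows defines a CSS code on $n$ qudits: the first $k$ rows are $X$-logical operators, the remaining rows generate the $X$-stabilizer space $\mathcal G_0$; logical basis states are $|\overline u\rangle\propto\sum_{\mathbf g\in\mathcal G_0}|\sum_{a\le k}u_a\mathbf g_a+\mathbf g\rangle$. ''Acts as the logical $N^{\otimes k}$'' means $N^{\otimes n}|\overline u\rangle=(-1)^{\sum_{a\le k}u_a^{q-1}}|\overline u\rangle$ for all $u\in\mathbb F_q^k$. The $Z$-distance is the minimum Hamming weight over $\mathbb F_q$ of a vector orthogonal (for $\sum x_iy_i$) to all stabilizer rows but not to at least one logical row. *)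

(* Defs.v *)
From mathcomp Require Import all_boot all_order all_algebra all_field.

Set Implicit Arguments.
Unset Strict Implicit.
Unset Printing Implicit Defensive.

Import GRing.Theory Num.Theory.
Local Open Scope ring_scope.

(* A register with computational basis T has state space {ffun T -> C^o}.
   Amplitudes are taken in an arbitrary numClosedFieldType C, which covers the
   complex numbers R[i].  A gate U is given by its matrix entries
   U x y = <x|U|y>. *)
Notation state C T := {ffun T -> C^o}.

Definition gate (C : numClosedFieldType) (T : finType) : Type := T -> T -> C.

Definition ket (C : numClosedFieldType) (T : finType) (x : T) : state C T :=
  [ffun y => (y == x)%:R].

Definition apply_gate (C : numClosedFieldType) (T : finType)
    (U : gate C T) (psi : state C T) : state C T :=
  [ffun x => \sum_y U x y * psi y].

Definition gate_comp (C : numClosedFieldType) (T : finType)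
    (U V : gate C T) : gate C T :=
  fun x y => \sum_z U x z * V z y.

Definition gate_tensor (C : numClosedFieldType) (T : finType) (n : nat)
    (U : gate C T) : gate C 'rV[T]_n :=
  fun x y => \prod_(j < n) U (x 0 j) (y 0 j).

Definition eq_up_to_phase (C : numClosedFieldType) (T : finType)
    (U V : gate C T) : Prop :=
  exists2 c : C, `|c| = 1 & forall x y, U x y = c * V x y.

Definition pauliX (C : numClosedFieldType) : gate C 'F_2 :=
  fun x y => (x == y + 1)%:R.
Arguments pauliX C : clear implicits.

(* C^{s-1}Z; the product of the bits is taken in 'F_2, then read in {0,1}. *)
Definition multiCZ (C : numClosedFieldType) (s : nat) : gate C 'rV['F_2]_s :=
  fun x y => (x == y)%:R * (-1) ^+ (\prod_(i < s) y 0%R i : 'F_2)%R.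
Arguments multiCZ C s : clear implicits.

Definition XmultiCZX (C : numClosedFieldType) (s : nat) : gate C 'rV['F_2]_s :=
  gate_comp (gate_tensor (pauliX C)) (gate_comp (multiCZ C s)
    (gate_tensor (pauliX C))).
Arguments XmultiCZX C s : clear implicits.

(* The element gamma^(q-1) of F, which is 0 or 1, read as a natural number. *)
Definition norm01 (F : finFieldType) (gamma : F) : nat :=
  (gamma ^+ #|F|.-1 == 1).

Definition norm_gate (C : numClosedFieldType) (F : finFieldType) : gate C F :=
  fun x y => (x == y)%:R * (-1) ^+ norm01 y.
Arguments norm_gate C F : clear implicits.

(* F of order 2^s, regarded as an 'F_2-vector space. *)
Notation F2space hF := (pPrimeCharType (card_finPcharP hF (isT : prime 2))).

(* Identification of an F-qudit with s qubits through the coordinates in b. *)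
Definition qubits (F : finFieldType) (s : nat) (hF : #|F| = (2 ^ s)%N)
    (b : s.-tuple (F2space hF)) (gamma : F) : 'rV['F_2]_s :=
  \row_(i < s) coord b i (gamma : F2space hF).

Definition qudit_gate (C : numClosedFieldType) (F : finFieldType) (s : nat)
    (hF : #|F| = (2 ^ s)%N) (b : s.-tuple (F2space hF))
    (U : gate C 'rV['F_2]_s) : gate C F :=
  fun x y => U (qubits b x) (qubits b y).

(* In a matrix G : 'M[F]_(k + r, n), the first k rows are the logical rows and
   the last r rows are the stabilizer rows. *)
Definition stabilizer_space (F : finFieldType) (k r n : nat)
    (G : 'M[F]_(k + r, n)) : {set 'rV[F]_n} :=
  [set g : 'rV[F]_n | (g <= dsubmx G)%MS].

Definition logical_state (C : numClosedFieldType) (F : finFieldType)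
    (k r n : nat) (G : 'M[F]_(k + r, n)) (u : 'rV[F]_k) :
    state C 'rV[F]_n :=
  (sqrtC #|stabilizer_space G|%:R)^-1 *:
    \sum_(g in stabilizer_space G)
      ket C (\sum_(a < k) u 0 a *: row a (usubmx G) + g).

Definition norm_acts_as_logical_norm (C : numClosedFieldType)
    (F : finFieldType) (k r n : nat) (G : 'M[F]_(k + r, n)) : Prop :=
  forall u : 'rV[F]_k,
    apply_gate (gate_tensor (norm_gate C F)) (logical_state C G u) =
    (-1) ^+ (\sum_(a < k) norm01 (u 0%R a))%N *: logical_state C G u.

(* U on every physical qudit implements U on every logical qudit, up to a
   global phase not depending on the encoded state. *)
Definition acts_as_logical (C : numClosedFieldType) (F : finFieldType)
    (k r n : nat) (G : 'M[F]_(k + r, n)) (U : gate C F) : Prop :=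
  exists2 c : C, `|c| = 1 &
    forall u : 'rV[F]_k,
      apply_gate (gate_tensor U) (logical_state C G u) =
      c *: \sum_(v : 'rV[F]_k) gate_tensor U v u *: logical_state C G v.

Definition hamming_weight (F : finFieldType) (n : nat) (y : 'rV[F]_n) : nat :=
  #|[set j | y 0 j != 0]|.

Definition nontrivial_Z_logical (F : finFieldType) (k r n : nat)
    (G : 'M[F]_(k + r, n)) (y : 'rV[F]_n) : Prop :=
  (forall i : 'I_r, \sum_(j < n) y 0 j * dsubmx G i j = 0) /\
  (exists a : 'I_k, \sum_(j < n) y 0 j * usubmx G a j <> 0).

Definition Z_distance_eq (F : finFieldType) (k r n : nat)
    (G : 'M[F]_(k + r, n)) (d : nat) : Prop :=
  (exists2 y, nontrivial_Z_logical G y & hamming_weight y = d) /\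
  (forall y, nontrivial_Z_logical G y -> (d <= hamming_weight y)%N).

(* G gives an  n C^{s-1}Z -> k C^{s-1}Z  distillation protocol at distance d:
   its code encodes k qudits of s qubits each into n of them, transversal
   C^{s-1}Z (conjugated by X on all qubits) acts as k logical such gates, and
   the Z-distance is d. *)
Definition CZ_distillation_protocol (C : numClosedFieldType)
    (F : finFieldType) (s : nat) (hF : #|F| = (2 ^ s)%N)
    (b : s.-tuple (F2space hF)) (r n k d : nat) (G : 'M[F]_(k + r, n)) :
    Prop :=
  [/\ row_free G,
      acts_as_logical G (qudit_gate b (XmultiCZX C s))
    & Z_distance_eq G d].

Definition code_matrix (F : finFieldType) (n : nat) (x : 'I_n -> F) :
    'M[F]_(2 + 1, n) :=
  \matrix_(i < 3, j < n) [:: x j ^+ 2; x j; 1]`_i.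

(* Main.v *)
(** Write gamma^(q-1) as the product of the Frobenius powers gamma^(2^i), i < s.
Expanding the norm of a codeword entry sum_c w_c g_(c,x) by additivity of
Frobenius and summing over x reduces the action of the transversal norm gate to
the sums of g_(a_1,x)^(2^0) ... g_(a_s,x)^(2^(s-1)).  Each of these is a power
sum over F with exponent E = sum_i e_i 2^i, where e_i <= 2 is the degree of row
a_i.  It is nonzero only for E = q-1 or E = 2(q-1); since E = q-1 has a unique
expansion with digits in {0, 1, 2}, all rows must then be equal, to x or to
x^2.  Amplitudes only depend on the parity of the resulting number of nonzero
entries, which can be read in F because its characteristic is 2. *)

Require Import Defs.
From mathcomp Require Import all_boot all_order all_algebra all_field.

Set Implicit Arguments.
Unset Strict Implicit.
Unset Printing Implicit Defensive.

Import GRing.Theory Num.Theory.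
Local Open Scope ring_scope.

(** * Power sums over a finite field and digits at most 2 *)

Lemma sum_pow2 s : (\sum_(i < s) 2 ^ i = (2 ^ s).-1)%N.
Proof. by rewrite [RHS]predn_exp mul1n. Qed.

Lemma expf_card1 (F : finFieldType) (x : F) : x != 0 -> x ^+ #|F|.-1 = 1.
Proof.
move=> x0; apply: (mulfI x0).
by rewrite -exprS mulr1 prednK ?expf_card // (ltn_trans _ (card_finNzRing_gt1 F)).
Qed.

Lemma power_sum_dvd (F : finFieldType) (E : nat) : (0 < E)%N ->
  (#|F|.-1 %| E)%N -> \sum_(x : F) x ^+ E = -1.
Proof.
move=> E0 /dvdnP[m defE].
rewrite (bigD1 0) //= expr0n gtn_eqF // add0r.
rewrite (eq_bigr (fun=> 1)); last first.
  by move=> x x0; rewrite defE mulnC exprM expf_card1 // expr1n.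
(* Translation by 1 permutes [F], so adding 1 to every term leaves the sum of all elements
   unchanged. *)
have H : \sum_(x : F) (1 : F) = 0.
  apply: (@addrI _ (\sum_(x : F) x)).
  by rewrite -big_split addr0 [RHS](reindex_inj (addIr 1)).
by apply/eqP; rewrite -addr_eq0 addrC; move: H; rewrite (bigD1 0) //= => ->.
Qed.

(** Scaling the variable by a nonzero [g] multiplies the sum by [g ^+ E], so one [g] with
    [g ^+ E != 1] suffices. Without such a [g], all nonzero elements would be roots of ['X^r - 1],
    where [r], the residue of [E], is positive and below their number. *)
Lemma power_sum_ndvd (F : finFieldType) (E : nat) :
  ~~ (#|F|.-1 %| E)%N -> \sum_(x : F) x ^+ E = 0.
Proof.
move=> ndv.
have q1 : (0 < #|F|.-1)%N by have := card_finNzRing_gt1 F; case: #|F| => [|[]].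
have [/existsP[g /andP[g0 gE]]|] := boolP [exists g : F, (g != 0) && (g ^+ E != 1)].
  have : \sum_(x : F) x ^+ E = g ^+ E * \sum_(x : F) x ^+ E.
    rewrite [LHS](reindex_inj (mulfI g0)) mulr_sumr /=.
    by apply: eq_bigr => x _; rewrite exprMn.
  move/eqP; rewrite -subr_eq0 -{1}[\sum_x _]mul1r -mulrBl mulf_eq0 subr_eq0.
  by rewrite eq_sym (negPf gE) => /eqP.
rewrite negb_exists => /forallP H.
pose r := (E %% #|F|.-1)%N.
have r0 : (0 < r)%N by rewrite lt0n.
have rootr (g : F) : g != 0 -> root ('X^r - 1%:P) g.
  move=> g0; move: (H g); rewrite g0 /= negbK => /eqP gE.
  rewrite rootE !hornerE subr_eq0 -gE [in X in _ == X](divn_eq E #|F|.-1).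
  by rewrite exprD mulnC exprM expf_card1 // expr1n mul1r.
have := @max_poly_roots F ('X^r - 1%:P) (enum (predC1 (0 : F))).
rewrite -size_poly_eq0 size_XnsubC // => /(_ isT).
have -> : all (root ('X^r - 1%:P)) (enum (predC1 (0 : F))).
  by apply/allP => g; rewrite mem_enum => /rootr.
rewrite enum_uniq -cardE cardC1 => /(_ isT isT).
by rewrite ltnS leqNgt ltn_pmod.
Qed.

(** Induction on [s]: for a positive number of digits the total is odd, so the lowest digit is 1;
    removing it and halving gives the same equation with one digit fewer. *)
Lemma binary_digits_eq1 s (e : 'I_s -> nat) : (forall i, (e i <= 2)%N) ->
  (\sum_(i < s) e i * 2 ^ i = (2 ^ s).-1)%N -> forall i, e i = 1%N.
Proof.
elim: s e => [e _ _ []//|s IH e e2].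
rewrite big_ord_recl expn0 muln1.
under eq_bigr do rewrite lift0 expnS mulnCA.
rewrite -big_distrr /= => H.
have pE : ((2 ^ s.+1).-1 = 1 + 2 * (2 ^ s).-1)%N.
  have : (0 < 2 ^ s)%N by rewrite expn_gt0.
  by rewrite expnS; case: (2 ^ s)%N => // m _; rewrite mulnS.
rewrite pE in H.
have e0 : e ord0 = 1%N.
  by have := congr1 odd H; rewrite !mul2n !oddD !odd_double;
    case: (e ord0) (e2 ord0) => [|[|[]]].
move: H; rewrite e0 => /addnI/eqP; rewrite eqn_mul2l /= => /eqP H i.
case: (unliftP ord0 i) => [j|] -> //.
exact: (IH (fun j => e (lift ord0 j))).
Qed.

Lemma rV_neq (V : zmodType) n (y z : 'rV[V]_n) :
  y != z -> exists j, y 0 j != z 0 j.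
Proof.
by rewrite -subr_eq0 => /rV0Pn[j]; rewrite !mxE subr_eq0; exists j.
Qed.

Lemma code_matrixE (F : finFieldType) n (x : 'I_n -> F) (c : 'I_(2 + 1)) j :
  code_matrix x c j = x j ^+ (2 - c).
Proof. by rewrite mxE; case: c => [[|[|[]]]]. Qed.

Lemma norm01E (F : finFieldType) (y : F) : norm01 y = (y != 0).
Proof.
rewrite /norm01; have [->|y0] := eqVneq y 0; last by rewrite expf_card1 ?eqxx.
(* The exponent is positive, so the convention [0 ^+ 0 = 1] does not interfere. *)
rewrite expr0n eq_sym; have := card_finNzRing_gt1 F.
by case: #|F| => [|[|m]] //= _; rewrite oner_eq0.
Qed.

Lemma gate_tensor_norm (C : numClosedFieldType)
    (F : finFieldType) m (y z : 'rV[F]_m) :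
  gate_tensor (norm_gate C F) y z =
  (y == z)%:R * (-1) ^+ (\sum_j norm01 (z 0%R j))%N.
Proof.
rewrite /gate_tensor /norm_gate big_split /= expr_sum; congr (_ * _).
have [->|yz] := eqVneq y z; first by rewrite big1 // => j _; rewrite eqxx.
have [j yzj] := rV_neq yz.
by rewrite (bigD1 j) //= (negPf yzj) mul0r.
Qed.

Lemma apply_gate_tensor_norm (C : numClosedFieldType)
    (F : finFieldType) m (psi : state C 'rV[F]_m) y :
  apply_gate (gate_tensor (norm_gate C F)) psi y =
  (-1) ^+ (\sum_j norm01 (y 0%R j))%N * psi y.
Proof.
rewrite ffunE (bigD1 y) //= gate_tensor_norm eqxx mul1r [X in _ + X]big1 ?addr0 // => z zy.
by rewrite gate_tensor_norm eq_sym (negPf zy) !mul0r.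
Qed.

(** * The transversal norm gate in characteristic 2 *)

Section Characteristic2.
Variables (F : finFieldType) (s : nat).
Hypothesis hF : #|F| = (2 ^ s)%N.

Let F2 : 2%N \in [pchar F] := card_finPcharP hF isT.

Lemma odd_natr_pchar2 m n : m%:R = n%:R :> F -> odd m = odd n.
Proof.
rewrite -(GRing.natr_mod_pchar F2) -[in RHS](GRing.natr_mod_pchar F2) !modn2.
by case: (odd m); case: (odd n) => // /eqP; rewrite ?oner_eq0 // eq_sym oner_eq0.
Qed.

Lemma norm01_prod (y : F) : (norm01 y)%:R = \prod_(i < s) y ^+ (2 ^ i).
Proof.
rewrite -expr_sum sum_pow2 -hF norm01E; have [->|y0] := eqVneq y 0.
  by rewrite expr0n; have := card_finNzRing_gt1 F; case: #|F| => [|[]].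
by rewrite expf_card1.
Qed.

Lemma exp_pow2_sum (I : finType) (f : I -> F) i :
  (\sum_c f c) ^+ (2 ^ i) = \sum_c f c ^+ (2 ^ i).
Proof.
have n2 : [pchar F].-nat (2 ^ i)%N.
  by rewrite (eq_pnat _ (pcharf_eq F2)) pnatX pnat_id.
apply: (big_morph (fun y : F => y ^+ (2 ^ i))).
  by move=> y z; rewrite exprDn_pchar.
by rewrite expr0n expn_eq0.
Qed.

Hypothesis s_gt0 : (0 < s)%N.

Lemma code_matrix_power_sum (x : 'I_(2 ^ s) -> F) (hx : bijective x)
    (a : 'I_s -> 'I_(2 + 1)) :
  \sum_(j < 2 ^ s) \prod_(i < s) code_matrix x (a i) j ^+ (2 ^ i) =
  (if [exists c : 'I_(2 + 1), (c < 2)%N && [forall i, a i == c]]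
   then 1 else 0).
Proof.
pose E := (\sum_(i < s) (2 - a i) * 2 ^ i)%N.
have -> : \sum_(j < 2 ^ s) \prod_(i < s) code_matrix x (a i) j ^+ (2 ^ i) =
    \sum_(y : F) y ^+ E.
  rewrite [RHS](reindex x) /=; last exact: onW_bij.
  apply: eq_bigr => j _; rewrite expr_sum; apply: eq_bigr => i _.
  by rewrite code_matrixE -exprM.
have q_gt1 : (1 < 2 ^ s)%N by rewrite -hF card_finNzRing_gt1.
have q1_gt0 : (0 < (2 ^ s).-1)%N by case: (2 ^ s)%N q_gt1 => [|[]].
case: ifPn => [/existsP[c /andP[c2 /forallP ac]]|].
  have EE : E = ((2 - c) * #|F|.-1)%N.
    rewrite hF -sum_pow2 big_distrr; apply: eq_bigr => i _.
    by rewrite (eqP (ac i)).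
  (* The power sum is -1, which is 1 in characteristic 2. *)
  rewrite power_sum_dvd ?oppr_pchar2 // EE ?dvdn_mull //.
  by rewrite muln_gt0 subn_gt0 c2 hF.
rewrite negb_exists => /forallP nc.
have const (c : 'I_(2 + 1)) : (c < 2)%N -> ~ forall i, a i = c.
  by move=> c2 ac; move: (nc c); rewrite c2 => /forallP[] i; rewrite ac.
have [/dvdnP[m Em]|] := boolP (#|F|.-1 %| E)%N; last exact: power_sum_ndvd.
(* The complementary digits [a i] bound [E] by [2 * (q - 1)], which leaves [m] in 0, 1, 2. *)
have EA : (E + \sum_(i < s) a i * 2 ^ i = 2 * (2 ^ s).-1)%N.
  rewrite -big_split -sum_pow2 big_distrr; apply: eq_bigr => i _ /=.
  by rewrite -mulnDl subnK // -ltnS.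
have m2 : (m <= 2)%N.
  by rewrite -(leq_pmul2r q1_gt0) -{1}hF -Em -EA leq_addr.
case: m m2 Em => [|[|[|//]]] _ Em.
(* For [m = 0] every term is 1, including the one at 0, and [q] copies of 1 vanish. *)
- under eq_bigr do rewrite Em expr0.
  by rewrite sumr_const cardT -cardE hF natrX (pcharf0 F2) expr0n gtn_eqF.
(* For [m = 1] all digits are 1, so every row is the row of [x]. *)
- case: (const (lift ord0 ord0)) => // i; apply/val_inj => /=.
  have : (2 - a i = 1)%N.
    apply: (binary_digits_eq1 (e := fun i => 2 - a i)%N) => [j|].
      exact: leq_subr.
    by rewrite -/E Em hF mul1n.
  by case: (a i) => [[|[|[]]]].
(* For [m = 2] the bound is attained, so every [a i] is 0 and every row is the row of [x ^+ 2]. *)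
- case: (const ord0) => // i; apply/val_inj => /=.
  move/eqP: EA; rewrite Em hF -[X in _ == X]addn0 eqn_add2l sum_nat_eq0.
  by move/forallP/(_ i); rewrite muln_eq0 expn_eq0 /= orbF => /eqP.
Qed.

Variables (k r n : nat) (G : 'M[F]_(k + r, n)).
Hypothesis power_sumG : forall a : 'I_s -> 'I_(k + r),
  \sum_(j < n) \prod_(i < s) G (a i) j ^+ (2 ^ i) =
  (if [exists c : 'I_(k + r), (c < k)%N && [forall i, a i == c]]
   then 1 else 0).

Lemma odd_norm01_combination (w : 'rV[F]_(k + r)) :
  odd (\sum_j norm01 ((w *m G)%R 0%R j)) =
  odd (\sum_(c < k + r | (c < k)%N) norm01 (w 0%R c)).
Proof.
apply: odd_natr_pchar2; rewrite !natr_sum.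
under eq_bigr => j _.
  rewrite mxE norm01_prod.
  under eq_bigr do rewrite exp_pow2_sum.
  rewrite bigA_distr_bigA /=.
  under eq_bigr do (under eq_bigr do rewrite exprMn; rewrite big_split /=).
  over.
rewrite exchange_big /=.
under eq_bigr => a _.
  rewrite -mulr_sumr power_sumG.
  (* A sum of indicators of constant functions can be exchanged with the sum over [a], which then
     collapses to one term per logical row. *)
  have -> : (if [exists c : 'I_(k + r), (c < k)%N && [forall i, a i == c]]
      then 1 else 0 : F) =
      \sum_(c < k + r | (c < k)%N) (a == [ffun=> c])%:R.
    have aE c : [forall i, a i == c] = (a == [ffun=> c]).
      apply/forallP/eqP => [ac|-> i]; last by rewrite ffunE.
      by apply/ffunP => i; rewrite ffunE; apply/eqP.
    case: ifPn => [/existsP[c /andP[ck]]|].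
      rewrite aE => /eqP ->; rewrite (bigD1 c) //= eqxx big1 ?addr0 // => d.
      (* Distinct constants give distinct functions because the index set is nonempty. *)
      case/andP=> _ dc; case: eqP => // /ffunP/(_ (Ordinal s_gt0)).
      by rewrite !ffunE => cd; rewrite cd eqxx in dc.
    rewrite negb_exists => /forallP nc; rewrite big1 // => c ck.
    by move: (nc c); rewrite ck aE /= => /negPf ->.
  rewrite mulr_sumr; over.
rewrite exchange_big /=; apply: eq_bigr => c _.
rewrite (bigD1 [ffun=> c]) //= eqxx mulr1 [X in _ + X]big1 ?addr0; last first.
  by move=> a /negPf ->; rewrite mulr0.
by rewrite norm01_prod; apply: eq_bigr => i _; rewrite ffunE.
Qed.

(** The gate is diagonal, and each basis state in the superposition is [row_mx u t *m G] for some
    [t]. Its sign depends on [u] alone and factors out. *)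
Lemma norm_acts_as_logical_norm_power_sum (C : numClosedFieldType) :
  norm_acts_as_logical_norm C G.
Proof.
move=> u; apply/ffunP => y; rewrite apply_gate_tensor_norm !ffunE.
rewrite [RHS]mulrCA [LHS]mulrCA; congr (_ * _).
rewrite !sum_ffunE ![_ * _]mulr_sumr; apply: eq_bigr => g.
rewrite inE => /submxP[t gE]; rewrite !ffunE.
case: eqP => [->|]; last by rewrite !mulr0.
congr (_ * _).
have -> : \sum_(a < k) u 0 a *: row a (usubmx G) + g = row_mx u t *m G.
  by rewrite -[in RHS](vsubmxK G) mul_row_col -mulmx_sum_row gE.
rewrite -signr_odd odd_norm01_combination big_split_ord /= signr_odd.
rewrite [X in (_ + X)%N]big_pred0 ?addn0; last first.
  by move=> i; rewrite ltnNge leq_addr.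
congr (_ ^+ _); apply: eq_big => [i|i _]; first exact: ltn_ord.
by rewrite row_mxEl.
Qed.

End Characteristic2.

(** * From the norm gate to the multi-controlled Z gate *)

Lemma acts_as_logical_phase (C : numClosedFieldType) (F : finFieldType)
    (k r n : nat) (G : 'M[F]_(k + r, n)) (U : gate C F) :
  eq_up_to_phase (norm_gate C F) U -> norm_acts_as_logical_norm C G ->
  acts_as_logical G U.
Proof.
move=> [c c1 NU] actN; have c0 : c != 0 by rewrite -normr_gt0 c1.
have tensorU m (y z : 'rV[F]_m) :
    gate_tensor U y z = c ^- m * gate_tensor (norm_gate C F) y z.
  rewrite /gate_tensor [in RHS](eq_bigr (fun j => c * U (y 0 j) (z 0 j))) //.
  by rewrite [in RHS]big_split /= prodr_const card_ord mulKf ?expf_neq0.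
(* The [n] physical gates contribute [c ^- n]; [c ^+ k] compensates for the phase of the [k] logical
   ones. *)
exists (c ^- n * c ^+ k) => [|u].
  by rewrite normrM normfV !normrX c1 !expr1n invr1 mulr1.
have -> : apply_gate (gate_tensor U) (logical_state C G u) =
    c ^- n *: apply_gate (gate_tensor (norm_gate C F)) (logical_state C G u).
  apply/ffunP => y; rewrite !ffunE [RHS]mulr_sumr.
  by apply: eq_bigr => z _; rewrite tensorU mulrA.
rewrite actN (bigD1 u) //= [X in _ + X]big1 ?addr0; last first.
  by move=> v vu; rewrite tensorU gate_tensor_norm (negPf vu) mul0r mulr0 scale0r.
rewrite tensorU gate_tensor_norm eqxx mul1r !scalerA; congr (_ *: _).
by rewrite !mulrA mulfK ?expf_neq0.
Qed.

Lemma F2_eq01 (t : 'F_2) : t = 0 \/ t = 1.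
Proof.
by case: t => [[|[|m]] i] //; [left|right]; apply: val_inj.
Qed.

Lemma gate_tensor_pauliX (C : numClosedFieldType) s (x y : 'rV['F_2]_s) :
  gate_tensor (pauliX C) x y = (x == y + const_mx 1)%:R.
Proof.
rewrite /gate_tensor /pauliX.
have [->|] := eqVneq x _; first by rewrite big1 // => j _; rewrite !mxE eqxx.
case/rV_neq=> j; rewrite !mxE => /negPf xj.
by rewrite (bigD1 j) //= xj mul0r.
Qed.

(** Flipping all bits before and after moves the sign from the all-ones string to the zero
    string. *)
Lemma XmultiCZXE (C : numClosedFieldType) s (x y : 'rV['F_2]_s) :
  XmultiCZX C s x y = (x == y)%:R * (-1) ^+ (y == 0).
Proof.
have y11 : y + const_mx 1 + const_mx 1 = y.
  rewrite -addrA -[RHS]addr0; congr (_ + _).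
  by apply/rowP => i; rewrite !mxE; apply: val_inj.
rewrite /XmultiCZX /gate_comp (bigD1 (y + const_mx 1)) //= gate_tensor_pauliX y11.
rewrite [X in _ + X]big1 ?addr0 => [|z zy]; last first.
  rewrite [X in _ * X]big1 ?mulr0 // => w _; rewrite gate_tensor_pauliX.
  case: eqP => [->|]; last by rewrite mulr0.
  by rewrite /multiCZ (negPf zy) !mul0r.
congr (_ * _); rewrite (bigD1 (y + const_mx 1)) //= gate_tensor_pauliX eqxx mulr1.
rewrite big1 ?addr0 => [|w wy]; last first.
  by rewrite gate_tensor_pauliX (negPf wy) mulr0.
rewrite /multiCZ eqxx mul1r; congr (_ ^+ _).
have [->|/rV0Pn[i yi]] := eqVneq y 0.
  by rewrite big1 // => i _; rewrite !mxE add0r.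
rewrite (bigD1 i) //= !mxE; move: yi.
by case: (F2_eq01 (y 0 i)) => -> //=.
Qed.

(** One gate has its signs on the nonzero elements, the other only at 0, so they differ by the
    global factor -1. Coordinates in a basis are injective, hence only 0 has zero coordinates. *)
Lemma norm_gate_XmultiCZX (C : numClosedFieldType) (F : finFieldType) (s : nat)
    (hF : #|F| = (2 ^ s)%N) (b : s.-tuple (F2space hF)) :
  basis_of fullv b ->
  eq_up_to_phase (norm_gate C F) (qudit_gate b (XmultiCZX C s)).
Proof.
move=> bb; exists (-1) => [|x y]; first by rewrite normrN1.
have inj : injective (qubits b).
  move=> u v /rowP uv.
  rewrite (coord_basis bb (memvf (u : F2space hF))).
  rewrite [RHS](coord_basis bb (memvf (v : F2space hF))).
  by apply: eq_bigr => i _; have := uv i; rewrite !mxE => ->.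
have q0 : qubits b 0 = 0 by apply/rowP => i; rewrite !mxE linear0.
rewrite /norm_gate /qudit_gate XmultiCZXE inj_eq // -q0 inj_eq // norm01E.
by rewrite mulrCA; case: (y == 0); rewrite ?expr0 ?expr1 ?mulrNN ?mulr1.
Qed.

(** * Rank and Z-distance *)

Lemma code_matrix_row_free (F : finFieldType) n (x : 'I_n -> F) :
  injective x -> (3 <= n)%N -> row_free (code_matrix x).
Proof.
move=> x_inj n3; apply: inj_row_free => v v0.
(* Row [c] has degree [2 - c], so [v] read backwards lists the coefficients of a polynomial of
   degree at most 2. It vanishes at [n >= 3] distinct points. *)
pose p := \poly_(i < 3) v 0 (rev_ord (inord i) : 'I_(2 + 1)).
have rootp : all (root p) (codom x).
  apply/allP => _ /codomP[j ->]; rewrite rootE horner_poly.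
  have := congr1 (fun w : 'rV_n => w 0 j) v0; rewrite !mxE => vj.
  apply/eqP; rewrite -[RHS]vj [RHS](reindex_inj rev_ord_inj); apply: eq_bigr => i _.
  rewrite code_matrixE inord_val; congr (_ * _ ^+ _).
  by case: i => [[|[|[]]]].
have p0 : p = 0.
  apply: (roots_geq_poly_eq0 rootp); first by rewrite map_inj_uniq ?enum_uniq.
  by rewrite size_codom card_ord (leq_trans (size_poly _ _)).
apply/rowP => c; rewrite mxE.
have := congr1 (fun p : {poly F} => p`_(rev_ord c)) p0.
by rewrite coef0 coef_poly ltn_ord inord_val rev_ordK.
Qed.

Lemma code_matrix_Z_distance (F : finFieldType) n (x : 'I_n -> F) :
  2%N \in [pchar F] -> injective x -> (2 <= n)%N ->
  Z_distance_eq (code_matrix x : 'M_(2 + 1, n)) 2.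
Proof.
move=> F2 x_inj n2.
have dE (i : 'I_1) j : dsubmx (code_matrix x : 'M_(2 + 1, n)) i j = 1.
  by rewrite mxE code_matrixE; case: i => [[]].
split=> [|y [y1 [a]]].
- pose j0 := Ordinal (ltnW n2); pose j1 := Ordinal n2.
  have j01 : j0 != j1 by [].
  pose y : 'rV[F]_n := \row_j (j \in [set j0; j1])%:R.
  have sumy (f : 'I_n -> F) : \sum_j y 0 j * f j = f j0 + f j1.
    rewrite (bigD1 j0) //= (bigD1 j1) 1?eq_sym //= !mxE !inE !eqxx orbT !mul1r.
    rewrite big1 ?addr0 // => j /andP[/negPf jj0 /negPf jj1].
    by rewrite mxE !inE jj0 jj1 mul0r.
  exists y; last first.
    rewrite /hamming_weight (_ : [set _ | _] = [set j0; j1]) ?cards2 //.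
    apply/setP => j; rewrite inE mxE.
    by case: (j \in [set j0; j1]); rewrite ?oner_eq0 ?eqxx.
  split=> [i|]; first by rewrite sumy !dE addrr_pchar2.
  (* Against the row of [x], the product is [x j0 + x j1], which is nonzero since [x] is injective
     and signs do not matter. *)
  exists ord_max; rewrite sumy !mxE /= => /eqP.
  by rewrite -[x j1](oppr_pchar2 F2) subr_eq0 (inj_eq x_inj) (negPf j01).
(* If [y] has weight at most 1, its product with the all-ones stabilizer row is its only possibly
   nonzero entry, so [y] vanishes. *)
- apply: contra_notT; rewrite -ltnNge ltnS => /card_le1_eqP le1.
  rewrite big1 // => j _.
  suff -> : y 0 j = 0 by rewrite mul0r.
  apply/eqP/negPn/negP => yj; move/eqP: (y1 ord0).
  rewrite (bigD1 j) //= dE mulr1 big1 ?addr0 ?(negPf yj) // => i ij.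
  have [->|yi] := eqVneq (y 0 i) 0; first by rewrite mul0r.
  by case/eqP: ij; apply: le1; rewrite inE.
Qed.

Theorem mainTheorem6 (C : numClosedFieldType) (s : nat) (hs : (2 <= s)%N)
    (F : finFieldType) (hF : #|F| = (2 ^ s)%N)
    (x : 'I_(2 ^ s) -> F) (hx : bijective x) :
  let G : 'M[F]_(2 + 1, 2 ^ s) := code_matrix x in
  [/\ row_free G,
      forall a : 'I_s -> 'I_(2 + 1),
        \sum_(j < 2 ^ s) \prod_(i < s) G (a i) j ^+ (2 ^ i)%N =
        (if [exists c : 'I_(2 + 1), (c < 2)%N && [forall i, a i == c]]
         then 1 else 0),
      norm_acts_as_logical_norm C G,
      Z_distance_eq G 2
    & forall b : s.-tuple (F2space hF), basis_of fullv b ->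
        eq_up_to_phase (norm_gate C F) (qudit_gate b (XmultiCZX C s)) /\
        @CZ_distillation_protocol C F s hF b 1 (2 ^ s) 2 2 G].
Proof.
have x_inj := bij_inj hx.
have s0 : (0 < s)%N := ltnW hs.
(* Here [s >= 2] provides the three evaluation points needed for full rank. *)
have q4 : (4 <= 2 ^ s)%N by rewrite (leq_pexp2l (m := 2) _ hs).
have powG := code_matrix_power_sum hF s0 hx.
have freeG := code_matrix_row_free x_inj (ltnW q4).
have actG := norm_acts_as_logical_norm_power_sum hF s0 powG C.
have distG := code_matrix_Z_distance (card_finPcharP hF isT) x_inj (ltnW (ltnW q4)).
split=> // b bb; have NX := norm_gate_XmultiCZX C bb.
by split=> //; split=> //; apply: acts_as_logical_phase.
Qed.
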